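(* For every fixed integer $k\ge 2$, the complete $k$-ary tree $T_n^k$ with $n$ leaves ($n$ a power of $k$) has a rectangular layout on the integer grid of area $O(n)$.
   Context: A (strong) rectangular layout of a graph is a set of axis-parallel rectangles with pairwise disjoint interiors, one per vertex, such that two rectangles' boundaries share a segment of positive length if and only if the corresponding vertices are adjacent. On the integer grid all corners have integer coordinates; the area is that of the smallest enclosing axis-parallel bounding box. *)

(* Defs.v *)
From HB Require Import structures.
From mathcomp Require Import all_boot all_order all_algebra.
From mathcomp Require Import all_classical all_reals all_analysis.

Set Implicit Arguments.
Unset Strict Implicit.
Unset Printing Implicit Defensive.

Import Order.TTheory GRing.Theory Num.Theory.
Import numFieldNormedType.Exports.

Local Open Scope classical_set_scope.
Local Open Scope ring_scope.

Section Rectangles.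
Variable R : realType.

Record rect := Rect {
  xmin : R; xmax : R; ymin : R; ymax : R;
  rect_x : xmin < xmax;
  rect_y : ymin < ymax }.

Definition region (r : rect) : set (R * R) :=
  [set` `[xmin r, xmax r]] `*` [set` `[ymin r, ymax r]].

Definition area (r : rect) : R := (xmax r - xmin r) * (ymax r - ymin r).

Definition on_grid (r : rect) : Prop :=
  [/\ xmin r \is a Num.int, xmax r \is a Num.int,
      ymin r \is a Num.int & ymax r \is a Num.int].

Definition boundary (A : set (R * R)) : set (R * R) := closure A `\` A°.

Definition segment (p q : R * R) : set (R * R) :=
  [set z | exists2 t : R, 0 <= t <= 1 &
     z = ((1 - t) * p.1 + t * q.1, (1 - t) * p.2 + t * q.2)].

Definition share_segment (r s : rect) : Prop :=
  exists p q : R * R, p <> q /\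
    segment p q `<=` boundary (region r) `&` boundary (region s).

Definition rectangular_layout (V : finType) (adj : rel V) (L : V -> rect) :
    Prop :=
  (forall u v, u <> v -> (region (L u))° `&` (region (L v))° = set0) /\
  (forall u v, u <> v -> (share_segment (L u) (L v) <-> adj u v)).

Definition encloses (V : finType) (L : V -> rect) (B : rect) : Prop :=
  forall v, region (L v) `<=` region B.

Definition bounding_box (V : finType) (L : V -> rect) (B : rect) : Prop :=
  encloses L B /\ forall B', encloses L B' -> region B `<=` region B'.

Lemma region_interior (r : rect) :
  (region r)° = [set` `]xmin r, xmax r[] `*` [set` `]ymin r, ymax r[].
Proof.
rewrite /region -!(interior_itv_bnd _ _ true false).
apply/seteqP; split => [[x y]|[x y]]; rewrite /interior /=.
  case=> [[A B]] /= [nA nB] sAB; split.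
    apply: filterS nA => a Aa.
    by have [] := sAB (a, y) (conj Aa (nbhs_singleton nB)).
  apply: filterS nB => b Bb.
  by have [] := sAB (x, b) (conj (nbhs_singleton nA) Bb).
by case=> hx hy; exists ([set` `[xmin r, xmax r]], [set` `[ymin r, ymax r]]).
Qed.

Lemma region_closure (r : rect) : closure (region r) = region r.
Proof.
apply/esym/closure_id.
have -> : region r = (fst @^-1` [set` `[xmin r, xmax r]]) `&`
                     (snd @^-1` [set` `[ymin r, ymax r]]) by [].
apply: closedI; apply: preimage_closed; try exact: interval_closed.
- by move=> z _; exact: cvg_fst.
- by move=> z _; exact: cvg_snd.
Qed.

End Rectangles.

Local Open Scope nat_scope.

(* A vertex is identified with the word of child indices leading to it from
   the root [::]. *)
Definition kary_vertex (k h : nat) : finType := h.-bseq 'I_k.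

Definition is_child (k h : nat) (v u : kary_vertex k h) : bool :=
  [exists c : 'I_k, val v == rcons (val u) c].

Definition kary_adj (k h : nat) : rel (kary_vertex k h) :=
  fun u v => is_child u v || is_child v u.

Definition kary_leaves (k h : nat) : {set kary_vertex k h} :=
  [set u : kary_vertex k h | [forall v, ~~ is_child v u]].

Lemma kary_leafE k h (u : kary_vertex k h) :
  0 < k -> (u \in kary_leaves k h) = (size (val u) == h).
Proof.
case: k u => // k u _; rewrite inE; apply/forallP/eqP => [leaf_u|size_u v].
  apply/eqP; rewrite eqn_leq size_bseq /= leqNgt; apply/negP => lt_uh.
  have le_uh : size (rcons (val u) (ord0 : 'I_k.+1)) <= h by rewrite size_rcons.
  by have /negP[] := leaf_u (Bseq le_uh); apply/existsP; exists ord0.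
apply/negP => /existsP[c /eqP eq_v].
by have := size_bseq v; rewrite [bseqval v]eq_v size_rcons size_u ltnn.
Qed.

Lemma card_kary_leaves k h : 0 < k -> #|kary_leaves k h| = k ^ h.
Proof.
move=> k0.
pose f (t : h.-tuple 'I_k) : kary_vertex k h :=
  Bseq (eq_leq (size_tuple t)).
have f_inj : injective f by move=> s t [] /val_inj.
have -> : kary_leaves k h = (f @: finset.setT)%SET.
  apply/setP => u; rewrite kary_leafE //; apply/idP/imsetP => [su|[t _ ->]].
    by exists (Tuple su); rewrite ?inE //; exact: val_inj.
  by rewrite /= size_tuple.
by rewrite card_imset // cardsT card_tuple card_ord.
Qed.

(* Main.v *)
Require Import Defs.
From mathcomp Require Import all_boot all_order all_algebra.
From mathcomp Require Import all_classical all_reals all_analysis.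
From mathcomp Require Import zify lra.

(** The layout is an H-tree.  A tree with [g.+2] levels is drawn with its root
    as a bar along the bottom of the box, its [k] children as vertical bars of
    width 1 standing on the root, and, to the right of each child, the boxes of
    its [k] subtrees with [g] levels stacked on top of each other.  The root bar
    of such a box reaches the left side of the box, so it touches its parent,
    while all other vertices of the box stay away from its left and bottom
    sides.  Two levels multiply each side of the box by about [k], and the number
    of leaves by [k ^ 2]. *)

Set Implicit Arguments.
Unset Strict Implicit.
Unset Printing Implicit Defensive.

Import Order.TTheory GRing.Theory Num.Theory.
Import numFieldNormedType.Exports.

Local Open Scope nat_scope.

(** * Integer boxes: contact and separation *)

Record box := Box { bx1 : nat; bx2 : nat; by1 : nat; by2 : nat }.

Definition shift (dx dy : nat) (b : box) : box :=
  Box (dx + bx1 b) (dx + bx2 b) (dy + by1 b) (dy + by2 b).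

Definition proper_box (b : box) := (bx1 b < bx2 b) && (by1 b < by2 b).

Definition touch (a b : box) : bool :=
  ((bx2 a == bx1 b) || (bx2 b == bx1 a)) &&
    ((by1 a < by2 b) && (by1 b < by2 a)) ||
  ((by2 a == by1 b) || (by2 b == by1 a)) &&
    ((bx1 a < bx2 b) && (bx1 b < bx2 a)).

(** The gap is strict, so even the closed boxes are disjoint: for non-adjacent vertices this yields
    both disjoint interiors and the absence of a common boundary segment. *)
Definition apart (a b : box) : bool :=
  [|| bx2 a < bx1 b, bx2 b < bx1 a, by2 a < by1 b | by2 b < by1 a].

Lemma touchC a b : touch a b = touch b a.
Proof. by rewrite /touch; lia. Qed.

Lemma apartC a b : apart a b = apart b a.
Proof. by rewrite /apart; lia. Qed.

Lemma touch_shift dx dy a b : touch (shift dx dy a) (shift dx dy b) = touch a b.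
Proof. by rewrite /touch /=; lia. Qed.

Lemma apart_shift dx dy a b : apart (shift dx dy a) (shift dx dy b) = apart a b.
Proof. by rewrite /apart /=; lia. Qed.

(** Columns and rows start at multiples of a symbolic pitch [m]; given this nonlinear fact, [lia]
    can treat the products as atoms. *)
Lemma ltn_mul_gap i j m : i < j -> i * m + m <= j * m.
Proof. by move=> ij; rewrite addnC -mulSn leq_mul2r ij orbT. Qed.

(** Recursion on both words lets the test reduce in step with [vertex_box], so common prefixes are
    stripped by computation. *)
Fixpoint extends_by_one (T : eqType) (u v : seq T) : bool :=
  match u, v with
  | [::], [:: _] => true
  | a :: u', b :: v' => (a == b) && extends_by_one u' v'
  | _, _ => false
  end.

Lemma extends_by_oneP (T : eqType) (u v : seq T) :
  reflect (exists c, v = rcons u c) (extends_by_one u v).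
Proof.
elim: u v => [|a u IH] [|b v] /=.
- by constructor=> -[].
- case: v => [|c v]; first by constructor; exists b.
  by constructor=> -[].
- by constructor=> -[].
- apply: (iffP andP) => [[/eqP <- /IH[c ->]]|[c [-> ->]]]; first by exists c.
  by split=> //; apply/IH; exists c.
Qed.

(** * The recursive drawing: size, containment, separation *)

Section HTree.
Variable k : nat.
Hypothesis k_gt1 : 1 < k.

(* [g] counts the levels of vertices, so [g = h.+1] for height [h], and [g = 0]
   is the empty tree. *)
Fixpoint tree_width (g : nat) : nat :=
  match g with
  | 0 => 0 | 1 => 1
  | g'.+2 => k * (tree_width g' + 2)
  end.

Fixpoint tree_height (g : nat) : nat :=
  match g with
  | 0 => 0 | 1 => 1
  | g'.+2 => (k * (tree_height g' + 1)).+1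
  end.

(** The [+ 2] in the column pitch is one unit of gap and one for the child's bar; the [+ 1] in the
    row pitch is a gap below each box. Boxes end flush with their column and row, so these gaps
    separate neighbours. *)
Fixpoint vertex_box (g : nat) (w : seq 'I_k) : box :=
  match w with
  | [::] => Box 0 (tree_width g) 0 1
  | [:: i] => let x := i * (tree_width g.-2 + 2) in
      Box x.+1 x.+2 1 (k * (tree_height g.-2 + 1)).+1
  | i :: j :: w' =>
      shift (i * (tree_width g.-2 + 2)).+2 (j * (tree_height g.-2 + 1)).+2
        (vertex_box g.-2 w')
  end.

(** The summands 4 absorb the additive terms of the recurrences: as [k] is at least 2, two more
    levels multiply each padded side by at most [k]. The constant 25 covers the base cases, where
    the product is 16 or 25. *)
Lemma tree_area g :
  (tree_width g + 4) * (tree_height g + 4) <= 25 * k ^ g.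
Proof.
have [m] := ubnP g; elim: m g => // m IH [|[|g]] //= gm; first by lia.
rewrite !expnS.
have {}IH : (tree_width g + 4) * (tree_height g + 4) <= 25 * k ^ g.
  by apply: IH; lia.
apply: (@leq_trans ((k * (tree_width g + 4)) * (k * (tree_height g + 4)))).
  by apply: leq_mul; nia.
by rewrite mulnACA -mulnA ![25 * (k * _)]mulnCA !leq_mul2l IH !orbT.
Qed.

Lemma tree_size_gt0 g : (0 < tree_width g.+1) && (0 < tree_height g.+1).
Proof. by case: g => [|g] //=; rewrite muln_gt0; lia. Qed.

Lemma vertex_box_in g w : size w < g ->
  [/\ proper_box (vertex_box g w), bx2 (vertex_box g w) <= tree_width g &
      by2 (vertex_box g w) <= tree_height g].
Proof.
have [m] := ubnP g; elim: m g w => // m IH [|g] [|i [|j w]] //= gm sw.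
- by have /andP[] := tree_size_gt0 g; rewrite /proper_box /=; split; lia.
- case: g gm sw => // g gm _ /=; rewrite /proper_box /=.
  by have := ltn_mul_gap (tree_width g + 2) (ltn_ord i); split; lia.
case: g gm sw => // g gm sw /=; rewrite /proper_box /=.
have [|//|/andP[? ?] ? ?] := IH g w; first by lia.
have := ltn_mul_gap (tree_width g + 2) (ltn_ord i).
have := ltn_mul_gap (tree_height g + 1) (ltn_ord j).
by split; lia.
Qed.

(** A child's bar runs along the left sides of its stacked boxes; this offset keeps it away from all
    but their root bars. *)
Lemma vertex_box_nonroot g i w :
  0 < bx1 (vertex_box g (i :: w)) /\ 0 < by1 (vertex_box g (i :: w)).
Proof. by case: w. Qed.

(** Needed for minimality of the bounding box: the root bar already reaches the other three
    sides. *)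
Lemma vertex_box_top g :
  exists2 w, size w < g.+1 & by2 (vertex_box g.+1 w) = tree_height g.+1.
Proof.
case: g => [|g]; first by exists [::].
by exists [:: Ordinal (ltnW k_gt1)].
Qed.

Lemma vertex_box_sep g u v : size u < g -> size v < g -> u != v ->
  if extends_by_one u v || extends_by_one v u
  then touch (vertex_box g u) (vertex_box g v)
  else apart (vertex_box g u) (vertex_box g v).
Proof.
have [m] := ubnP g; elim: m g u v => // m IH g u v gm.
wlog uv : u v / size u <= size v => [wl su sv neq|].
  have [uv|/ltnW vu] := leqP (size u) (size v); first exact: wl.
  by rewrite orbC touchC apartC; apply: wl; rewrite // eq_sym.
have ord_neq (i j : 'I_k) : i != j -> (i < j) || (j < i).
  by rewrite -val_eqE neq_ltn.
case: g gm => // -[|g] gm.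
  by case: u v uv => [|i u] [|j v].
case: u v uv => [|i [|i' u]] [|j [|j' v]] //= _ su sv neq.
- have := ltn_mul_gap (tree_width g + 2) (ltn_ord j).
  by rewrite /touch /=; lia.
- by rewrite /apart /=; lia.
- have ij : i != j by apply: contraNneq neq => ->.
  rewrite (eq_sym j) (negbTE ij) /=.
  have /orP[] := ord_neq _ _ ij => /(ltn_mul_gap (tree_width g + 2));
    by rewrite /apart /=; lia.
(* A child's bar against a vertex inside a box: in the same column it touches exactly when that
   vertex is the root of the box; distinct columns are separated by the gap. *)
- rewrite andbF orbF.
  have [|/andP[lx ly] x2 y2] := @vertex_box_in g v; first by lia.
  have hj' := ltn_mul_gap (tree_height g + 1) (ltn_ord j').
  have [<-|ij] /= := eqVneq i j.
    case: v {neq sv} lx ly x2 y2 => [|a v] lx ly x2 y2.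
      by rewrite /touch /=; lia.
    have [] := vertex_box_nonroot g a v.
    by rewrite /apart; case: (vertex_box g (a :: v)) => /=; lia.
  have /orP[] := ord_neq _ _ ij => /(ltn_mul_gap (tree_width g + 2));
    by rewrite /apart /=; lia.
(* Both vertices lie inside boxes: distinct columns or rows are separated by gaps, and within one
   box the common shift cancels and induction applies. *)
- have [|/andP[? ?] ? ?] := @vertex_box_in g u; first by lia.
  have [|/andP[? ?] ? ?] := @vertex_box_in g v; first by lia.
  have [eij|ij] := eqVneq i j; last first.
    have /orP[] := ord_neq _ _ ij => /(ltn_mul_gap (tree_width g + 2));
      by rewrite /apart /=; lia.
  have [eij'|ij] := eqVneq i' j'; last first.
    have /orP[] := ord_neq _ _ ij => /(ltn_mul_gap (tree_height g + 1));
      by rewrite /apart /=; lia.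
  rewrite -eij -eij' /= touch_shift apart_shift.
  apply: IH; [exact: ltnW | exact: su | exact: sv |].
  by apply: contraNneq neq => ->; rewrite eij eij'.
Qed.

End HTree.

Local Open Scope classical_set_scope.
Local Open Scope ring_scope.

(** * From integer boxes to real rectangles *)

Section Geometry.
Variable R : realType.

Definition rect_of_box (b : box) (p : proper_box b) : rect R :=
  @Rect R (bx1 b)%:R (bx2 b)%:R (by1 b)%:R (by2 b)%:R
    (etrans (ltr_nat R _ _) (proj1 (andP p)))
    (etrans (ltr_nat R _ _) (proj2 (andP p))).

Lemma on_grid_rect_of_box b (p : proper_box b) : on_grid (rect_of_box p).
Proof. by split; rewrite /= natr_int. Qed.

Lemma regionE (r : rect R) z :
  region r z = [/\ xmin r <= z.1 <= xmax r & ymin r <= z.2 <= ymax r] :> Prop.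
Proof. by rewrite /region /= !in_itv. Qed.

Lemma interior_regionE (r : rect R) z :
  (region r)° z = [/\ xmin r < z.1 < xmax r & ymin r < z.2 < ymax r] :> Prop.
Proof. by rewrite region_interior /= !in_itv. Qed.

Lemma segment_corner (p q : R * R) : segment p q p.
Proof.
exists 0; first by rewrite lexx ler01.
by rewrite subr0 !mul1r !mul0r !addr0; case: p.
Qed.

(** Regions are closed, hence contain their boundaries, so an endpoint of a shared segment would lie
    in both. *)
Lemma region_disjoint_no_share (r s : rect R) :
  region r `&` region s = set0 -> ~ share_segment r s.
Proof.
move=> rs0 [p [q [_ /(_ p (segment_corner p q))]]].
rewrite /boundary !region_closure => -[[rp _] [sp _]].
by have : (region r `&` region s) p by []; rewrite rs0.
Qed.

Lemma apart_region (a b : box) (pa : proper_box a) (pb : proper_box b) :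
  apart a b -> region (rect_of_box pa) `&` region (rect_of_box pb) = set0.
Proof.
move=> ab; apply/seteqP; split=> // z; rewrite /setI /= !regionE /=.
move=> [[/andP[h1 h2] /andP[h3 h4]] [/andP[h5 h6] /andP[h7 h8]]].
have := le_trans h1 h6; have := le_trans h5 h2.
have := le_trans h3 h8; have := le_trans h7 h4.
by rewrite !ler_nat; move: ab; rewrite /apart; lia.
Qed.

Lemma touch_interior (a b : box) (pa : proper_box a) (pb : proper_box b) :
  touch a b ->
  (region (rect_of_box pa))° `&` (region (rect_of_box pb))° = set0.
Proof.
move=> ab; apply/seteqP; split=> // z; rewrite /setI /= !interior_regionE /=.
move=> [[/andP[h1 h2] /andP[h3 h4]] [/andP[h5 h6] /andP[h7 h8]]].
have := lt_trans h1 h6; have := lt_trans h5 h2.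
have := lt_trans h3 h8; have := lt_trans h7 h4.
by rewrite !ltr_nat; move: ab; rewrite /touch; lia.
Qed.

Lemma convex_between (m M x y t : R) :
  0 <= t <= 1 -> m <= x <= M -> m <= y <= M ->
  m <= (1 - t) * x + t * y <= M.
Proof. by move=> /andP[? ?] /andP[? ?] /andP[? ?]; apply/andP; split; nra. Qed.

Lemma vertical_segment_boundary (r : rect R) (x y1 y2 : R) :
  x = xmin r \/ x = xmax r -> ymin r <= y1 <= ymax r ->
  ymin r <= y2 <= ymax r ->
  segment (x, y1) (x, y2) `<=` boundary (region r).
Proof.
move=> xr h1 h2 z [t t01 ->] /=.
have -> : (1 - t) * x + t * x = x by rewrite -mulrDl subrK mul1r.
have rx := ltW (rect_x r).
rewrite /boundary region_closure; split.
  rewrite regionE /=; split; last exact: convex_between.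
  by case: xr => ->; rewrite lexx ?andbT.
by rewrite interior_regionE /= => -[+ _]; case: xr => ->; rewrite ltxx ?andbF.
Qed.

Lemma horizontal_segment_boundary (r : rect R) (y x1 x2 : R) :
  y = ymin r \/ y = ymax r -> xmin r <= x1 <= xmax r ->
  xmin r <= x2 <= xmax r ->
  segment (x1, y) (x2, y) `<=` boundary (region r).
Proof.
move=> yr h1 h2 z [t t01 ->] /=.
have -> : (1 - t) * y + t * y = y by rewrite -mulrDl subrK mul1r.
have ry := ltW (rect_y r).
rewrite /boundary region_closure; split.
  rewrite regionE /=; split; first exact: convex_between.
  by case: yr => ->; rewrite lexx ?andbT.
by rewrite interior_regionE /= => -[_ +]; case: yr => ->; rewrite ltxx ?andbF.
Qed.

Lemma touch_share (a b : box) (pa : proper_box a) (pb : proper_box b) :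
  touch a b -> share_segment (rect_of_box pa) (rect_of_box pb).
Proof.
have /andP[ax ay] := pa; have /andP[bx by_] := pb.
case/orP=> /andP[ends over].
  (* The shared segment lies on the line at coordinate [c] and spans the overlap from [lo] to [hi],
     which is nondegenerate because the overlap is strict. *)
  pose c := if bx2 a == bx1 b then bx2 a else bx1 a.
  pose lo := maxn (by1 a) (by1 b); pose hi := minn (by2 a) (by2 b).
  exists (c%:R, lo%:R), (c%:R, hi%:R); split.
    by move=> [] /eqP; rewrite eqr_nat /lo /hi; lia.
  move=> z sz; split; move: z sz; apply: vertical_segment_boundary => /=;
    rewrite ?ler_nat /lo /hi; try lia; rewrite /c;
    case: eqP ends => [E _|_ /= /eqP E]; rewrite ?E; by [left|right].
pose c := if by2 a == by1 b then by2 a else by1 a.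
pose lo := maxn (bx1 a) (bx1 b); pose hi := minn (bx2 a) (bx2 b).
exists (lo%:R, c%:R), (hi%:R, c%:R); split.
  by move=> [] /eqP; rewrite eqr_nat /lo /hi; lia.
move=> z sz; split; move: z sz; apply: horizontal_segment_boundary => /=;
  rewrite ?ler_nat /lo /hi; try lia; rewrite /c;
  case: eqP ends => [E _|_ /= /eqP E]; rewrite ?E; by [left|right].
Qed.

Lemma encloses_corners (V : finType) (L : V -> rect R) (B : rect R) v :
  encloses L B ->
  [/\ xmin B <= xmin (L v), xmax (L v) <= xmax B,
      ymin B <= ymin (L v) & ymax (L v) <= ymax B].
Proof.
move=> /(_ v) LB; have rx := ltW (rect_x (L v)); have ry := ltW (rect_y (L v)).
have /LB : region (L v) (xmin (L v), ymin (L v)) by rewrite regionE /= !lexx.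
have /LB : region (L v) (xmax (L v), ymax (L v)).
  by rewrite regionE /= !lexx !andbT.
by rewrite !regionE /= => -[/andP[_ ?] /andP[_ ?]] [/andP[? _] /andP[? _]].
Qed.

Lemma sub_region (r s : rect R) :
  [/\ xmin s <= xmin r, xmax r <= xmax s, ymin s <= ymin r & ymax r <= ymax s] ->
  region r `<=` region s.
Proof.
move=> [h1 h2 h3 h4] z; rewrite !regionE => -[/andP[z1 z2] /andP[z3 z4]].
by split; apply/andP; split; eapply le_trans; eauto.
Qed.

End Geometry.

(** * Assembly into a layout of the tree *)

Lemma kary_adjE k h (u v : kary_vertex k h) :
  kary_adj u v = extends_by_one (val u) (val v) || extends_by_one (val v) (val u).
Proof.
have childE (x y : kary_vertex k h) : is_child y x = extends_by_one (val x) (val y).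
  apply/existsP/extends_by_oneP => -[c].
    by move/eqP; exists c.
  by exists c; apply/eqP.
by rewrite /kary_adj !childE orbC.
Qed.

Theorem theorem8 (R : realType) (k : nat) (hk : (2 <= k)%N) :
  exists C : R, forall n h : nat, n = (k ^ h)%N ->
    exists (L : kary_vertex k h -> rect R) (B : rect R),
      [/\ rectangular_layout (@kary_adj k h) L,
          (forall v, on_grid (L v)),
          bounding_box L B
        & (area B <= C * n%:R)%R].
Proof.
(* Height [h] means [h.+1] levels, so the area bound is [25 * k ^ h.+1]; the extra factor [k] goes
   into the constant. *)
exists (25 * k)%:R => _ h ->.
have sz (v : kary_vertex k h) : (size (val v) < h.+1)%N.
  by rewrite ltnS size_bseq.
have pv (v : kary_vertex k h) : proper_box (vertex_box h.+1 (val v)).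
  by have [] := vertex_box_in hk (sz v).
pose W := tree_width k h.+1; pose H := tree_height k h.+1.
have pB : proper_box (Box 0 W 0 H) by exact: tree_size_gt0.
pose L (v : kary_vertex k h) := rect_of_box R (pv v).
exists L, (rect_of_box R pB); split.
- have sep (u v : kary_vertex k h) : u <> v ->
    if kary_adj u v then touch (vertex_box h.+1 (val u)) (vertex_box h.+1 (val v))
    else apart (vertex_box h.+1 (val u)) (vertex_box h.+1 (val v)).
    move=> uv; rewrite kary_adjE; apply: vertex_box_sep => //.
    by apply/eqP => /val_inj.
  split=> u v /sep; case: ifP => adj uv.
  + exact: touch_interior.
  + apply/seteqP; split=> // z [/interior_subset zu /interior_subset zv].
    by rewrite -(apart_region R (pv u) (pv v) uv).
  + by split=> // _; exact: touch_share.
  + by split=> // /region_disjoint_no_share; case; exact: apart_region.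
- by move=> v; exact: on_grid_rect_of_box.
- split=> [v|B' encB'].
    have [_ xW yH] := vertex_box_in hk (sz v).
    by apply: sub_region; split; rewrite /= ler_nat.
  (* Any enclosing rectangle contains the root bar, which forces its left, right and bottom bounds;
     the top one comes from a vertex of maximal height. *)
  pose root : kary_vertex k h := [bseq].
  have [r1 r2 r3 r4] := encloses_corners root encB'.
  apply: sub_region; split=> //=.
  have [w szw topw] := vertex_box_top hk h.
  have [_ _ _] := encloses_corners (Bseq szw) encB'.
  by rewrite /= topw.
- rewrite /area /= !subr0 -!natrM ler_nat.
  apply: leq_trans (leq_trans (tree_area hk h.+1) _).
    by apply: leq_mul; exact: leq_addr.
  by rewrite expnS mulnA.
Qed.
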